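(* Assume the Continuum Hypothesis. Then every productively Lindelöf sequential $T_3$ space is powerfully Lindelöf.
   Context: A topological space is productively Lindelöf if its product with every Lindelöf space is Lindelöf. A space $X$ is powerfully Lindelöf if its countable power $X^\omega$ (with the Tychonoff product topology) is Lindelöf. *)

(* Defs.v *)
From HB Require Import structures.
From mathcomp Require Import all_boot all_order all_algebra.
From mathcomp Require Import all_classical.
From mathcomp Require Import topology_structure separation_axioms product_topology function_spaces.
Set Implicit Arguments. Unset Strict Implicit. Unset Printing Implicit Defensive.
Local Open Scope classical_set_scope.

Definition lindelof (X : topologicalType) : Prop :=
  forall C : set (set X), C `<=` open -> \bigcup_(A in C) A = setT ->
    exists D : set (set X), [/\ D `<=` C, countable D & \bigcup_(A in D) A = setT].

Definition productively_lindelof (X : topologicalType) : Prop :=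
  forall Y : topologicalType, lindelof Y -> lindelof (X * Y)%type.

(* Powerfully Lindelöf: the countable power X^omega, with the Tychonoff
   product topology, is Lindelöf. *)
Definition powerfully_lindelof (X : topologicalType) : Prop :=
  lindelof {ptws nat -> X}.

Definition sequentially_closed (X : topologicalType) (A : set X) : Prop :=
  forall (u : nat -> X) (x : X), (forall n, A (u n)) -> u @ \oo --> x -> A x.

Definition sequential_space (X : topologicalType) : Prop :=
  forall A : set X, sequentially_closed A -> closed A.

Definition T3_space (X : topologicalType) : Prop :=
  regular_space X /\ accessible_space X.

Definition CH : Prop :=
  forall A : set (set nat), countable A \/ (A #= [set: set nat])%card.

(* Main.v *)
(** Fix a family of open sets [B a], indexed by [a : Om], and a closed [Y].  The sets of
    indices whose open sets fail to cover [Y] ("non-covers") form a subset [N] of the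
    compact space [2^Om], which plays the role of [Y] inside a compactification; a
    compact subset of [N] is given by a family of forbidden finite sets.  Under CH
    everything relevant is enumerated in type omega_1.  Productive Lindelöfness of the
    ambient space says that every Lindelöf set of covers is separated from [N] by
    countably many closed sets.  From this one gets Alster's theorem: if every compact
    subset of [N] lies in one of the given closed G_delta sets, then countably many of
    them cover [N].  For otherwise let [D I] be the union of the given sets with index
    in the countable initial segment [I]; the covers [z] included in some [I] but not
    in [D I] form a Lindelöf set not separated from [N].  That it is Lindelöf rests on
    a Baire category argument in a closed-off countable stage, where [N] restricted
    to the stage is sigma-compact, again by separation.

    Alster's theorem yields the Lindelöf property of the countable power of [Y]: one
    chooses compact factors one at a time so that no G_delta neighbourhood of the finite
    product so far is countably covered, against compactness of the full product.

    Finally [X^omega] reduces to [Y^omega] for a [Y] of size at most continuum, closed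
    under limits of sequences (hence closed, as [X] is sequential), and a family of
    continuum many open sets closed off so that a countable family of boxes which
    covers [Y^omega] covers [X^omega]. *)
Require Import Defs.
From HB Require Import structures.
From mathcomp Require Import all_boot.
From mathcomp Require Import all_classical wochoice topology_structure separation_axioms.
From mathcomp Require Import product_topology bool_topology supremum_topology.
From mathcomp Require Import function_spaces.
Set Implicit Arguments. Unset Strict Implicit. Unset Printing Implicit Defensive.
Local Open Scope classical_set_scope.

(** * Alster's theorem for non-covers *)

Lemma sub_mem_cat (T : eqType) (F G : seq T) (z : set T) :
  [set` F ++ G] `<=` z <-> [set` F] `<=` z /\ [set` G] `<=` z.
Proof.
split=> [FGz|[Fz Gz] a /=]; last by rewrite mem_cat => /orP[/Fz|/Gz].
by split=> a /= aF; apply: FGz; rewrite /= mem_cat aF ?orbT.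
Qed.

Lemma countable_surj T U (A : set T) (B : set U) (f : T -> U) :
  countable A -> B `<=` f @` A -> countable B.
Proof.
move=> cA BA; apply: (sub_countable (subset_card_le BA)).
exact: (sub_countable (card_image_le _ _)).
Qed.

Lemma countable_seq_in (T : eqType) (A : set T) :
  countable A -> countable [set F : seq T | [set` F] `<=` A].
Proof.
move=> /countable_injP[f fI]; apply/countable_injP.
exists (fun F => choice.pickle (map f F)) => F G /[!inE] FA GA.
move=> /(pcan_inj choice.pickleK); elim: F G FA GA => [|a F IH] [|b G] //= FA GA.
move=> -[fab /IH FG]; congr (_ :: _).
  by apply: fI fab; rewrite inE; [apply: FA|apply: GA]; rewrite /= mem_head.
by apply: FG => c cF; [apply: FA|apply: GA]; rewrite /= inE orbC [c \in _]cF.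
Qed.

Lemma countable_of_seq (T : eqType) (F : seq T) : countable [set` F].
Proof.
apply/countable_injP; exists (index^~ F) => x y /[!inE] xF yF.
exact: index_inj.
Qed.

Lemma countableU T (A B : set T) :
  countable A -> countable B -> countable (A `|` B).
Proof.
move=> cA cB; rewrite -bigcup2E; apply: bigcup_countable => // -[|[|n]] _ //=.
Qed.

Section Alster.
Variable Om : choiceType.
Implicit Types (z w I : set Om) (F G : seq Om) (O : set (seq Om)).

(* The closed subsets of [2^Om] of this form are those closed under subsets; only they
   matter, because non-covers are closed under subsets. *)
Definition avoid O : set (set Om) :=
  [set z | forall F, O F -> ~ [set` F] `<=` z].

Lemma avoid_sub O z w : w `<=` z -> avoid O z -> avoid O w.
Proof. by move=> wz az F OF Fw; apply: (az F OF); apply: subset_trans wz. Qed.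

Lemma avoidS O O' : O `<=` O' -> avoid O' `<=` avoid O.
Proof. by move=> OO z az F /OO; apply: az. Qed.

Lemma not_avoid O z : ~ avoid O z -> exists2 F, O F & [set` F] `<=` z.
Proof.
by move=> nz; apply: contrapT => h; apply: nz => F OF Fz; apply: h; exists F.
Qed.

Definition letters O : set Om := \bigcup_(F in O) [set` F].

Lemma avoid_letters O I z : letters O `<=` I -> avoid O (z `&` I) -> avoid O z.
Proof.
move=> OI az F OF Fz; apply: (az F OF) => a Fa; split; first exact: Fz.
by apply: OI; exists F.
Qed.

Lemma countable_letters O : countable O -> countable (letters O).
Proof. by move=> cO; apply: bigcup_countable => // F _; apply: countable_of_seq. Qed.

Variable le : Om -> Om -> Prop.
Definition cut I := countable I /\ forall a b, le a b -> I b -> I a.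

(** Codes of countable families of finite sets, so that each [avoid (e a)] is a closed G_delta
    subset of [2^Om]. *)
Variable e : Om -> set (seq Om).
Variable N : set (set Om).

Definition omega1_order :=
  [/\ (forall a, le a a), (forall a b c, le a b -> le b c -> le a c),
      (forall a b, le a b \/ le b a),
      (forall a, countable [set b | le b a]) &
      ~ countable [set: Om]].

(** When [N] consists of the non-covers, the second clause is the Lindelöf property: a cover has a
    countable subcover. *)
Definition countably_witnessed :=
  (forall z w, w `<=` z -> N z -> N w) /\
  (forall z, ~ N z -> exists w, [/\ countable w, w `<=` z & ~ N w]).

(** The second premise on [P] is the Lindelöf property for the topology whose basic open sets are
    the sets of all [z] including a given finite set. *)
Definition separates_lindelof :=
  forall P : set (set Om), (forall z, P z -> ~ N z) ->
  (forall O, (forall z, P z -> ~ avoid O z) ->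
    exists O', [/\ countable O', O' `<=` O & forall z, P z -> ~ avoid O' z]) ->
  exists A : set Om, [/\ countable A,
    (forall a z, A a -> P z -> ~ avoid (e a) z) &
    forall z, N z -> exists2 a, A a & avoid (e a) z].

Hypothesis leP : omega1_order.
Hypothesis e_count : forall a, countable (e a).
Hypothesis NP : countably_witnessed.
Hypothesis sepP : separates_lindelof.

Let lexx : forall a, le a a. Proof. by case: leP. Qed.
Let le_trans : forall a b c, le a b -> le b c -> le a c. Proof. by case: leP. Qed.
Let le_total : forall a b, le a b \/ le b a. Proof. by case: leP. Qed.
Let le_count : forall a, countable [set b | le b a]. Proof. by case: leP. Qed.

Lemma cut_cover A : countable A -> exists2 I, cut I & A `<=` I.
Proof.
move=> cA; exists (\bigcup_(a in A) [set b | le b a]); last first.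
  by move=> a Aa; exists a => //=; apply: lexx.
split; first exact: bigcup_countable.
by move=> a b ab [c Ac /= bc]; exists c => //=; apply: le_trans bc.
Qed.

Lemma cut_total I J : cut I -> cut J -> I `<=` J \/ J `<=` I.
Proof.
move=> [_ dI] [_ dJ]; have [|nIJ] := pselect (I `<=` J); first by left.
right=> b Jb; have [a /not_implyP[Ia nJa]] : exists a, ~ (I a -> J a).
  by apply/existsNP => h; apply: nIJ => a; apply: h.
by case: (le_total a b) => [/dJ/(_ Jb)//|/dI/(_ Ia)].
Qed.

Variable H : set Om.
Hypothesis HP : forall O, avoid O `<=` N ->
  exists2 a, H a & avoid O `<=` avoid (e a).

Let D I : set (set Om) := [set z | exists a, [/\ I a, H a & avoid (e a) z]].

Let DS I J : I `<=` J -> D I `<=` D J.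
Proof. by move=> IJ z [a [Ia Ha az]]; exists a; split=> //; apply: IJ. Qed.

Let supp I := \bigcup_(a in I) letters (e a).

Let supp_count I : cut I -> countable (supp I).
Proof.
by case=> cI _; apply: bigcup_countable => // a _; apply: countable_letters.
Qed.

Let D_supp I J z : supp I `<=` J -> D I (z `&` J) -> D I z.
Proof.
move=> IJ [a [Ia Ha az]]; exists a; split=> //; apply: avoid_letters az.
by move=> b ab; apply: IJ; exists a.
Qed.

Let P : set (set Om) :=
  [set z | exists I, [/\ cut I, z `<=` I, ~ N z & ~ D I z]].

(** The aim is that a closed set [avoid O] missing [P] lies in a single [D I]; this section refutes
    the opposite case, [big]. *)
Section Bounded.
Variable O : set (seq Om).
Hypothesis PO : forall z, P z -> ~ avoid O z.
Hypothesis big : forall I, cut I -> exists2 z, avoid O z & ~ D I z.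

Let small F := exists2 I, cut I & forall z, avoid O z -> [set` F] `<=` z -> D I z.
Let O' := O `|` small.

(* Discarding the small finite sets is a Cantor-Bendixson step that terminates at
   once: membership in [D I] depends only on countably many indices. *)
Let kernel F I : avoid O' [set` F] -> cut I ->
  exists z, [/\ avoid O' z, [set` F] `<=` z & ~ D I z].
Proof.
move=> aF cI; apply: contrapT => h.
have {h} inD z : avoid O' z -> [set` F] `<=` z -> D I z.
  by move=> az Fz; apply: contrapT => nD; apply: h; exists z.
have [J cJ JP] : exists2 J, cut J & I `|` [set` F] `|` supp I `<=` J.
  apply: cut_cover; apply: countableU; last exact: supp_count.
  by apply: countableU; [case: cI|apply: countable_of_seq].
have /choice[j jP] G : exists jG, small G ->
    cut jG /\ forall z, avoid O z -> [set` G] `<=` z -> D jG z.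
  by have [[K cK KP]|nG] := pselect (small G); [exists K|exists set0].
have [K cK KP] : exists2 K, cut K &
    I `|` \bigcup_(G in [set G | [set` G] `<=` J] `&` small) j G `<=` K.
  apply: cut_cover; apply: countableU; first by case: cI.
  apply: bigcup_countable; last by move=> G [_ /jP[[]]].
  apply: (sub_countable _ (countable_seq_in (proj1 cJ))).
  by apply: subset_card_le => G [].
(* It remains to see that [F] itself is small, with bound [K]. A point [z] including a small set
   inside [J] is handled by the choice of [K]; for any other [z], the trace on [J] avoids [O'], and
   membership in [D I] depends only on that trace. *)
apply: (aF F); last by [].
right; exists K => // z az Fz.
have [[G [GJ sG Gz]]|nG] :=
    pselect (exists G, [/\ [set` G] `<=` J, small G & [set` G] `<=` z]).
  have /jP[_ /(_ z az Gz)] := sG.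
  by apply: DS => a ja; apply: KP; right; exists G.
suff : D I (z `&` J).
  move=> /D_supp DI; apply: (@DS I) => [a Ia|]; first by apply: KP; left.
  by apply: DI => a sa; apply: JP; right.
apply: inD; last by move=> a Fa; split; [apply: Fz|apply: JP; left; right].
move=> G [OG|sG] GzJ; first by apply: (az G OG) => a /GzJ[].
by apply: nG; exists G; split=> // a /GzJ[].
Qed.

Let avoid_nil : avoid O' [set` [::]].
Proof.
move=> G OG G0.
have {}G0 z : [set` G] `<=` z by move=> a /G0; rewrite /= in_nil.
case: OG => [OG|[I cI IP]].
  have [z az _] := big (conj (@countable0 Om) (fun _ _ _ => id) : cut set0).
  exact: (az G OG).
by have [z az] := big cI; apply; apply: IP.
Qed.

(** Otherwise the part of [avoid O'] above [F] is a compact subset of [N], so by [HP] it lies in one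
    set [avoid (e a)] and hence in some [D I], against [kernel]. *)
Let escape F : avoid O' [set` F] ->
  exists z, [/\ avoid O' z, [set` F] `<=` z, countable z & ~ N z].
Proof.
move=> aF; apply: contrapT => h.
have [NS Nw] := NP.
have {h} inN z : avoid O' z -> [set` F] `<=` z -> N z.
  move=> az Fz; apply: contrapT => /Nw[w [cw wz nw]]; apply: h.
  have wFz : w `|` [set` F] `<=` z by move=> a [/wz|/Fz].
  exists (w `|` [set` F]); split.
  - exact: avoid_sub az.
  - by move=> a; right.
  - by apply: countableU => //; apply: countable_of_seq.
  - by apply: contra_not nw; apply: NS => a; left.
(* [avoid OF] consists of the [z] whose union with [F] avoids [O']. *)
pose OF : set (seq Om) := [set G | exists2 K, O' K & [set` K] `<=` [set` G ++ F]].
have [|a Ha OFa] := @HP OF.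
  move=> z az; apply: (NS (z `|` [set` F])); first by move=> a; left.
  apply: inN; last by move=> a; right.
  move=> K OK Kz; apply: (az [seq a <- K | a \notin F]).
    exists K => // a /= aK; rewrite mem_cat mem_filter [a \in K]aK andbT.
    by rewrite orNb.
  by move=> a /=; rewrite mem_filter => /andP[/negP aF' /Kz[]].
have [I cI IP] := cut_cover (countable1 a).
have [z [az Fz]] := kernel aF cI; apply; exists a; split=> //; first exact: IP.
apply: OFa => G [K OK KG] Gz; apply: (az K OK) => b /KG /=.
by rewrite mem_cat => /orP[/Gz|/Fz].
Qed.

Lemma unbounded_avoid_contra : False.
Proof.
have [NS _] := NP.
have /choice[zF zFP] F : exists z, avoid O' [set` F] ->
    [/\ avoid O' z, [set` F] `<=` z, countable z & ~ N z].
  have [/escape[z]|n] := pselect (avoid O' [set` F]); first by exists z.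
  by exists set0.
have /choice[g gP] I : exists J, cut I -> [/\ cut J, I `<=` J, supp I `<=` J &
    forall F, [set` F] `<=` I -> avoid O' [set` F] -> zF F `<=` J].
  have [cI|] := pselect (cut I); last by exists I.
  have [J cJ JP] : exists2 J, cut J & I `|` supp I `|`
     \bigcup_(F in [set F | [set` F] `<=` I] `&` [set F | avoid O' [set` F]]) zF F
       `<=` J.
    apply: cut_cover; apply: countableU.
      by apply: countableU; [case: cI|apply: supp_count].
    apply: bigcup_countable; last by move=> F [_ /zFP[]].
    apply: (sub_countable _ (countable_seq_in (proj1 cI))).
    by apply: subset_card_le => G [].
  exists J => _; split=> // [a Ia|a sa|F FI aF a za]; apply: JP.
  - by left; left.
  - by left; right.
  - by right; exists F.
pose T n := iter n g set0; pose th := \bigcup_n T n.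
have cT n : cut (T n).
  by elim: n => [|n IH]; [split|case: (gP _ IH)].
have Tm : {homo T : m n / (m <= n)%N >-> m `<=` n}.
  apply: homo_leq => [K|K L M LK KM|n]; [by []|exact: subset_trans KM|].
  by case: (gP _ (cT n)).
have cth : cut th.
  split; first by apply: bigcup_countable => // n _; case: (cT n).
  by move=> a b ab [n _ nb]; exists n => //; case: (cT n) => _ /(_ a b ab); apply.
have th_fin F : [set` F] `<=` th -> exists n, [set` F] `<=` T n.
  elim: F => [|a F IH] aFth; first by exists 0%N.
  have [b Fb|n Fn] := IH; first by apply: aFth; rewrite /= inE orbC [b \in F]Fb.
  have [m _ ma] : th a by apply: aFth; rewrite /= mem_head.
  exists (maxn m n) => b /=; rewrite inE => /orP[/eqP->|bF].
    exact: Tm (leq_maxl _ _) _ ma.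
  exact: Tm (leq_maxr _ _) _ (Fn b bF).
have th_supp a : th a -> letters (e a) `<=` th.
  move=> [n _ na] b ab; exists n.+1 => //.
  by case: (gP _ (cT n)) => _ _ + _; apply; exists a.
have th_z F : [set` F] `<=` th -> avoid O' [set` F] -> zF F `<=` th.
  move=> /th_fin[n Fn] aF b zb; exists n.+1 => //.
  by case: (gP _ (cT n)) => _ _ _; apply; eauto.
(* The countable set [th] has only countably many finite subsets, so the Lindelöf premise is
   immediate. Thus [N] is covered by countably many closed sets that miss every cover inside
   [th]. *)
have [|C OC|A [cA PA NA]] := @sepP [set z | z `<=` th /\ ~ N z].
- by move=> z [].
- exists (C `&` [set F | [set` F] `<=` th]); split=> [||z [zth nz] az].
  + apply: (sub_countable _ (countable_seq_in (proj1 cth))).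
    by apply: subset_card_le => G [].
  + by move=> F [].
  + apply: (OC z) => // F CF Fz; apply: (az F) => //; split=> //.
    exact: subset_trans zth.
pose Q := (th `&` H) `|` A.
have cQ : countable Q.
  apply: countableU => //; apply: (sub_countable _ (proj1 cth)).
  by apply: subset_card_le => G [].
(* Baire category: each closed set [avoid (e a)], a in Q, is nowhere dense. *)
have step F a : [set` F] `<=` th -> avoid O' [set` F] -> Q a ->
    exists G, [/\ [set` F ++ G] `<=` th, avoid O' [set` F ++ G] & e a G].
  move=> Fth aF Qa.
  suff [z [az Fz [G aG [Gth Gz]]]] : exists z, [/\ avoid O' z, [set` F] `<=` z &
      exists2 G, e a G & [set` G] `<=` th /\ [set` G] `<=` z].
    exists G; split=> //; first by apply/sub_mem_cat.
    by apply: avoid_sub az; apply/sub_mem_cat.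
  (* For [a] in [H], [kernel] gives a point outside [D th]; for [a] in [A], the cover [zF F] lies
     inside [th] and so outside [avoid (e a)]. *)
  case: Qa => [[tha Ha]|Aa].
    have [z [az Fz nD]] := kernel aF cth; exists z; split=> //.
    have [az'|G aG Gz] := @not_avoid (e a) z; first by apply: nD; exists a.
    exists G => //; split=> // b Gb; apply: (th_supp a) => //.
    by exists G.
  have [az Fz _ nz] := zFP F aF; exists (zF F); split=> //.
  have zth := th_z F Fth aF.
  have [|G aG Gz] := @not_avoid (e a) (zF F); first exact: PA.
  by exists G => //; split=> //; apply: subset_trans zth.
have /choice[s sP] (aF : Om * seq Om) : exists G, Q aF.1 ->
    [set` aF.2] `<=` th -> avoid O' [set` aF.2] ->
    [/\ [set` aF.2 ++ G] `<=` th, avoid O' [set` aF.2 ++ G] & e aF.1 G].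
  case: aF => a F /=.
  have [Qa|] := pselect (Q a); last by exists [::].
  have [Fth|] := pselect ([set` F] `<=` th); last by exists [::].
  have [aF|] := pselect (avoid O' [set` F]); last by exists [::].
  by have [G] := step F a Fth aF Qa; exists G.
have [q Qq] : exists q : nat -> option Om, forall a, Q a -> exists n, q n = Some a.
  have /countable_injP[f fI] := cQ.
  have /choice[q qP] n : exists qn, (exists2 a, Q a & f a = n) ->
      exists a, [/\ qn = Some a, Q a & f a = n].
    have [[a Qa fa]|] := pselect (exists2 a, Q a & f a = n); last by exists None.
    by exists (Some a) => _; exists a.
  exists q => a Qa; exists (f a).
  have [|b [-> Qb fb]] := qP (f a); first by exists a.
  by congr Some; apply: fI fb; rewrite inE.
pose nxt n F := if q n is Some a then if `[< Q a >] then F ++ s (a, F) else F else F.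
pose W := fix W n := if n is m.+1 then nxt m (W m) else [::].
have WP n : [set` W n] `<=` th /\ avoid O' [set` W n].
  elim: n => [|n [IH1 IH2]]; first by split=> // a; rewrite /= in_nil.
  rewrite /= /nxt; case: (q n) => // a; case: asboolP => // Qa.
  by have [] := sP (a, W n).
have Wm : {homo W : m n / (m <= n)%N >-> {subset m <= n}}.
  apply: homo_leq => [x|y x z xy yz a /xy/yz|n a] //=.
  rewrite /nxt; case: (q n) => // b; case: asboolP => // _.
  by rewrite mem_cat => ->.
pose z := \bigcup_n [set` W n].
have z_fin F : [set` F] `<=` z -> exists n, [set` F] `<=` [set` W n].
  elim: F => [|a F IH] aFz; first by exists 0%N.
  have [b Fb|n Fn] := IH; first by apply: aFz; rewrite /= inE orbC [b \in F]Fb.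
  have [m _ /= ma] : z a by apply: aFz; rewrite /= mem_head.
  exists (maxn m n) => b /=; rewrite inE => /orP[/eqP->|bF].
    exact: Wm (leq_maxl _ _) _ ma.
  exact: Wm (leq_maxr _ _) _ (Fn b bF).
have zQ a : Q a -> ~ avoid (e a) z.
  move=> Qa; have [n qn] := Qq a Qa.
  have [W1 W2] := WP n; have [_ _ asa] := sP (a, W n) Qa W1 W2.
  apply: contra_not id _ => /(_ _ asa); apply=> b bs; exists n.+1 => //=.
  by rewrite /nxt qn asboolT // mem_cat orbC [b \in s _]bs.
have az : avoid O z.
  by move=> F OF /z_fin[n Fn]; apply: ((WP n).2 F) => //; left.
have zth : z `<=` th by move=> a [n _]; apply: (WP n).1.
(* Were [z] a cover, it would be in [P] with cut [th], being outside [D th]; but [avoid O] misses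
   [P]. *)
have Nz : N z.
  apply: contrapT => nz; apply: (PO _ az); exists th; split=> // -[a [tha Ha]].
  by apply: zQ; left.
by have [a Aa] := NA z Nz; apply: zQ; right.
Qed.

End Bounded.

(** That closed sets missing [P] are bounded by cuts is used twice: it makes [P] Lindelöf, and it
    puts the countably many sets separating [P] from [N] into one [D I]. *)
Theorem alster : exists2 A : set Om, countable A /\ A `<=` H &
  forall z, N z -> exists2 a, A a & avoid (e a) z.
Proof.
apply: contrapT => nA.
have ND I : cut I -> exists2 z, N z & ~ D I z.
  move=> [cI _]; apply: contrapT => h; apply: nA; exists (I `&` H).
    split; last by move=> a [].
    by apply: sub_countable cI; apply: subset_card_le => a [].
  move=> z Nz; apply: contrapT => h'; apply: h; exists z => // -[a [Ia Ha az]].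
  by apply: h'; exists a.
have bounded O : (forall z, P z -> ~ avoid O z) ->
    exists2 I, cut I & avoid O `<=` D I.
  move=> PO; apply: contrapT => h; apply: (unbounded_avoid_contra PO) => I cI.
  apply: contrapT => h'; apply: h; exists I => // z az.
  by apply: contrapT => nD; apply: h'; exists z.
have [|O PO|A [cA PA NA]] := @sepP P.
- by move=> z [I []].
- have [I cI ID] := bounded O PO.
  have [J cJ JP] : exists2 J, cut J & I `|` supp I `<=` J.
    by apply: cut_cover; apply: countableU; [case: cI|apply: supp_count].
  exists (O `&` [set F | [set` F] `<=` J]); split=> [||z Pz az].
  + apply: (sub_countable _ (countable_seq_in (proj1 cJ))).
    by apply: subset_card_le => G [].
  + by move=> F [].
  + have aJ : avoid O (z `&` J).
      by move=> F OF FzJ; apply: (az F) => [|a /FzJ[]//]; split=> // a /FzJ[].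
    have DIz : D I z by apply: D_supp (ID _ aJ) => a sa; apply: JP; right.
    have [K [cK zK _ nDK]] := Pz.
    (* If [K] is the smaller cut, [z] lies inside [J] and so avoids all of [O]. *)
    have [IK|KI] := cut_total cI cK; first by apply: nDK; apply: DS DIz.
    apply: (PO z Pz); rewrite (_ : z = z `&` J) //.
    by apply/seteqP; split=> [a za|a []//]; split=> //; apply/JP; left; apply/KI/zK.
- have /choice[j jP] a : exists ja, A a -> cut ja /\ avoid (e a) `<=` D ja.
    have [Aa|] := pselect (A a); last by exists set0.
    by have [z Pz|I] := bounded (e a); [apply: PA|exists I].
  have [I cI IP] : exists2 I, cut I & \bigcup_(a in A) j a `<=` I.
    by apply: cut_cover; apply: bigcup_countable => // a /jP[[]].
  have [z Nz] := ND I cI; apply; have [a Aa /(proj2 (jP a Aa))] := NA z Nz.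
  by apply: DS => b jb; apply: IP; exists a.
Qed.

End Alster.

(** * Countable powers *)

Section Power.
Variables (Om : choiceType) (le : Om -> Om -> Prop).
Variables (e : Om -> set (seq Om)) (N : set (set Om)).
Hypothesis leP : omega1_order le.
Hypothesis e_count : forall a, countable (e a).
Hypothesis e_surj : forall O, countable O -> exists a, e a = O.
Hypothesis NP : countably_witnessed N.
Hypothesis sepP : separates_lindelof e N.

(** A list [s] codes a basic box of the power. If [x i] holds the indices of the open sets missing
    the [i]-th coordinate of a point, then [x] dodges [s] exactly when the point is in the box. *)
Definition dodge (x : nat -> set Om) (s : seq (nat * Om)) :=
  forall p, p \in s -> ~ x p.1 p.2.

Variable BB : set (seq (nat * Om)).
Hypothesis BBP : forall x, (forall i, N (x i)) -> exists2 s, BB s & dodge x s.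

Let small n (O : nat -> set (seq Om)) := exists C, [/\ countable C, C `<=` BB &
  forall x, (forall i, N (x i)) -> (forall i, (i < n)%N -> avoid (O i) (x i)) ->
    exists2 s, C s & dodge x s].

Let good (k : seq (set (seq Om))) := forall O,
  (forall i, (i < size k)%N ->
    countable (O i) /\ avoid (nth set0 k i) `<=` avoid (O i)) ->
  ~ small (size k) O.

(** If every compact candidate failed, each would lie in a closed G_delta set coded in [H], and
    Alster's theorem would cover coordinate [n] by countably many of these. *)
Let good_extend k : good k -> exists2 K, avoid K `<=` N & good (rcons k K).
Proof.
move=> gk; apply: contrapT => h.
pose n := size k.
pose near (O : nat -> set (seq Om)) := forall i, (i < n)%N ->
  countable (O i) /\ avoid (nth set0 k i) `<=` avoid (O i).
pose H : set Om := [set a | exists O, [/\ near O, small n.+1 O & O n = e a]].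
have HP O : avoid O `<=` N -> exists2 a, H a & avoid O `<=` avoid (e a).
  move=> ON.
  have : ~ good (rcons k O) by move=> g; apply: h; exists O.
  move=> /existsNP[Q /not_implyP[QP /contrapT]]; rewrite size_rcons => sQ.
  rewrite size_rcons in QP; have [cQn OQ] := QP n (ltnSn n).
  have [a ea] := e_surj cQn; exists a; last first.
    by move: OQ; rewrite nth_rcons ltnn eqxx ea.
  exists Q; split=> // i ltin; have := QP i (ltnW ltin).
  by rewrite nth_rcons ltin.
have [A [cA AH] AN] := alster leP e_count NP sepP HP.
have /choice[Oa OaP] a : exists O, A a -> [/\ near O, small n.+1 O & O n = e a].
  by have [/AH[O]|] := pselect (A a); [exists O|exists (fun=> set0)].
have /choice[C CP] a : exists C, A a -> [/\ countable C, C `<=` BB &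
    forall x, (forall i, N (x i)) ->
      (forall i, (i < n.+1)%N -> avoid (Oa a i) (x i)) ->
      exists2 s, C s & dodge x s].
  by have [/OaP[_ [C]]|] := pselect (A a); [exists C|exists set0].
(* Uniting families intersects the closed sets they define, and countable families stay
   countable. *)
apply: (gk (fun i => \bigcup_(a in A) Oa a i)).
  move=> i ltik; split.
    by apply: bigcup_countable => // a /OaP[/(_ i ltik)[]].
  move=> z az F [a Aa]; have [/(_ i ltik)[_ /(_ z az) h'] _ _] := OaP a Aa.
  exact: h'.
exists (\bigcup_(a in A) C a); split.
- by apply: bigcup_countable => // a /CP[].
- by move=> s [a /CP[_ CB _] /CB].
move=> x Nx ax; have [a Aa ea] := AN (x n) (Nx n).
have [_ _ /(_ x Nx) Ca] := CP a Aa; have [i|s Cs ds] := Ca; last first.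
  by exists s => //; exists a.
rewrite ltnS leq_eqVlt => /orP[/eqP->|lti].
  by have [_ _ ->] := OaP a Aa.
by apply: avoidS (ax i lti) => F OF; exists a.
Qed.

Section Compactness.
Variable K : nat -> set (seq Om).
Hypothesis KN : forall i, avoid (K i) `<=` N.
Hypothesis Kgood : forall n, good (mkseq K n).

Let goodE n O : (forall i, (i < n)%N -> countable (O i)) ->
  (forall i, (i < n)%N -> avoid (K i) `<=` avoid (O i)) -> ~ small n O.
Proof.
move=> cO KO; have := @Kgood n O; rewrite size_mkseq; apply => i lti.
by rewrite nth_mkseq //; split; [apply: cO|apply: KO].
Qed.

(** Compactness of the product by an ultrafilter limit: [X L] is a point missed by the finite list
    [L], and lists are directed by inclusion. A box containing the limit contains [X L] for almost
    all [L], hence for some [L] listing that box. *)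
Let finite_subcover : exists L : seq (seq (nat * Om)),
  forall x, (forall i, avoid (K i) (x i)) ->
    exists s, [/\ s \in L, BB s & dodge x s].
Proof.
apply: contrapT => h.
have /choice[X XP] (L : seq (seq (nat * Om))) : exists x : nat -> set Om,
    (forall i, avoid (K i) (x i)) /\ forall s, s \in L -> BB s -> ~ dodge x s.
  apply: contrapT => hL; apply: h; exists L => x ax; apply: contrapT => hx.
  by apply: hL; exists x; split=> // s sL Bs ds; apply: hx; exists s.
have FF : ProperFilter (filter_from [set: seq (seq (nat * Om))]
    (fun L0 => [set L : seq (seq (nat * Om)) | {subset L0 <= L}])).
  apply: filter_from_proper; last by move=> L _; exists L.
  apply: filter_from_filter; first by exists [::].
  move=> L1 L2 _ _; exists (L1 ++ L2) => // L LL.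
  by split=> s sL; apply: LL; rewrite mem_cat sL ?orbT.
have [U [UU FU]] := ultraFilterLemma FF.
pose x i : set Om := [set a | U [set L | X L i a]].
have ax i : avoid (K i) (x i).
  move=> F KF Fx.
  have : U [set L | [set` F] `<=` X L i].
    elim: F Fx {KF} => [_|a F IH aFx].
      by apply: filterS filterT => L _ a; rewrite /= in_nil.
    have /IH : [set` F] `<=` x i.
      by move=> b Fb; apply: aFx; rewrite /= inE orbC [b \in F]Fb.
    have : x i a by apply: aFx; rewrite /= mem_head.
    apply: filterS2 => L Xa XF b /=; rewrite inE => /orP[/eqP->//|].
    exact: XF.
  by move=> /filter_ex[L]; apply: (XP L).1.
have [s Bs ds] := BBP (fun i => KN (ax i)).
have : U [set L | dodge (X L) s].
  elim: s {Bs} ds => [_|p s IH ds].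
    by apply: filterS filterT => L _ p; rewrite in_nil.
  have /IH : dodge x s by move=> q qs; apply: ds; rewrite inE qs orbT.
  have : U (~` [set L | X L p.1 p.2]).
    have [Up|//] := in_ultra_setVsetC [set L | X L p.1 p.2] UU.
    by have := ds p (mem_head _ _).
  by apply: filterS2 => L Xp Xs q; rewrite inE => /orP[/eqP->|/Xs].
have : U [set L | s \in L].
  apply: FU; exists [:: s] => // L /=; apply.
  exact: mem_head.
move=> Us Ud; have [L [sL dL]] := filter_ex (filterI Us Ud).
exact: (XP L).2 dL.
Qed.

Lemma no_good_sequence : False.
Proof.
(* Every factor is nonempty: otherwise the family [[set [::]]], which nothing avoids, at place [i]
   gives an empty tube, covered by no boxes at all. *)
have K0 i : avoid (K i) set0.
  apply: contrapT => n0.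
  apply: (@goodE i.+1 (fun j => if j == i then [set [::]] else set0)) => [j _|j _|].
  - by case: eqP.
  - by case: eqP => [->|_] z az F //; case: n0; apply: avoid_sub az.
  exists set0; split=> // x _ /(_ i (ltnSn i)); rewrite eqxx.
  by move=> /(_ [::] erefl); case=> a; rewrite /= in_nil.
have [L LP] := finite_subcover.
pose S : set Om := [set` map snd (flatten L)].
pose n := (\max_(p <- flatten L) p.1).+1.
have inL s p : s \in L -> p \in s -> p \in flatten L.
  by move=> sL ps; apply/flattenP; exists s.
(* A set avoids this family exactly when its trace on the finite set [S] avoids [K i]. Boxes in [L]
   see only indices in [S] and coordinates below [n], so later coordinates may be replaced by
   [set0]. *)
apply: (@goodE n (fun i => [set F | [set` F] `<=` S /\ ~ avoid (K i) [set` F]])).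
- move=> i _; apply: (sub_countable _ (countable_seq_in (countable_of_seq _))).
  by apply: subset_card_le => F [FS _]; exact: FS.
- by move=> i _ z az F [_ nF] Fz; apply: nF; apply: avoid_sub az.
exists ([set` L] `&` BB); split=> [||x Nx ax].
- apply: (sub_countable _ (countable_of_seq L)).
  by apply: subset_card_le => s [].
- by move=> s [].
have [i|s [sL Bs ds]] := LP (fun i => if (i < n)%N then x i `&` S else set0).
  case: ifP => // lti F KF Fx; apply: (ax i lti F) => [|a /Fx[]//].
  split=> [a /Fx[]//|aF]; exact: (aF F).
exists s => // p ps xp; apply: (ds p ps).
rewrite ltnS leq_bigmax_seq ?(inL s) //; split=> //.
by apply/mapP; exists p => //; apply: inL ps.
Qed.

End Compactness.

Theorem countable_subcover_power : exists C, [/\ countable C, C `<=` BB &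
  forall x, (forall i, N (x i)) -> exists2 s, C s & dodge x s].
Proof.
apply: contrapT => h.
have g0 : good [::].
  by move=> O _ [C [cC CB CP]]; apply: h; exists C; split=> // x Nx; apply: CP.
have /choice[nxt nxtP] k : exists K, good k -> avoid K `<=` N /\ good (rcons k K).
  by have [/good_extend[K]|] := pselect (good k); [exists K|exists set0].
pose W := fix W n := if n is m.+1 then rcons (W m) (nxt (W m)) else [::].
have Wg n : good (W n) by elim: n => //= n /nxtP[].
apply: (@no_good_sequence (fun n => nxt (W n))) => n.
  by have [] := nxtP _ (Wg n).
suff -> : mkseq (fun n => nxt (W n)) n = W n by [].
by elim: n => //= n IH; rewrite mkseqS IH.
Qed.

End Power.

(** * Non-covers in a productively Lindelöf space *)

(** The topology below gives [inl t] the neighbourhoods determined by finite subsets of [p t], and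
    makes each [inr a], standing for the point [x a], isolated. The parameters occur in the type so
    that the topology can depend on them. *)
Definition test_space (T Om : Type) (p : T -> set Om) (x : Om -> set Om) : Type :=
  (T + Om)%type.

Section TestSpace.
Variables (T : Type) (Om : choiceType) (p : T -> set Om) (x : Om -> set Om).
Local Notation Z := (test_space p x).

Definition test_open (U : set Z) := forall t, U (inl t) ->
  exists F : seq Om, [/\ [set` F] `<=` p t,
    forall t', [set` F] `<=` p t' -> U (inl t') &
    forall a, [set` F] `<=` x a -> U (inr a)].

Lemma test_openT : test_open setT.
Proof. by move=> t _; exists [::]; split=> // a; rewrite /= in_nil. Qed.

Lemma test_openI : setI_closed test_open.
Proof.
move=> U V oU oV t [/oU[F [Fp FU FU']] /oV[G [Gp GV GV']]].
exists (F ++ G); split=> [|t'|a]; rewrite sub_mem_cat //.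
  by move=> [Ft Gt]; split; [apply: FU|apply: GV].
by move=> [Ft Gt]; split; [apply: FU'|apply: GV'].
Qed.

Lemma test_open_bigU (I : Type) (f : I -> set Z) :
  (forall i, test_open (f i)) -> test_open (\bigcup_i f i).
Proof.
move=> of_ t [i _ /(of_ i)[F [Fp FU FU']]]; exists F; split=> // [t' Ft'|a Fa].
  by exists i => //; apply: FU.
by exists i => //; apply: FU'.
Qed.

HB.instance Definition _ := gen_eqMixin Z.
HB.instance Definition _ := gen_choiceMixin Z.
HB.instance Definition _ := isOpenTopological.Build Z
  test_openT test_openI test_open_bigU.

Lemma open_test (U : set Z) : test_open U -> open U.
Proof. by []. Qed.

Lemma test_openP (U : set Z) : open U -> test_open U.
Proof. by []. Qed.
End TestSpace.

Lemma openX (S T : topologicalType) (A : set S) (B : set T) :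
  open A -> open B -> open (A `*` B).
Proof.
move=> oA oB; rewrite openE => -[a b] [/= Aa Bb].
by exists (A, B) => //; split; apply: open_nbhs_nbhs.
Qed.

Lemma lindelof_bool : lindelof bool.
Proof.
move=> C oC CT.
have [A CA At] : (\bigcup_(A in C) A) true by rewrite CT.
have [A' CA' At'] : (\bigcup_(A in C) A) false by rewrite CT.
exists ([set A] `|` [set A']); split.
- by move=> _ [->|->].
- by apply: countableU; apply: countable1.
- apply/seteqP; split=> // -[] _; first by exists A => //; left.
  by exists A' => //; right.
Qed.

Lemma productively_lindelof_lindelof X : productively_lindelof X -> lindelof X.
Proof.
move=> /(_ _ lindelof_bool) LX C oC CT.
have [||D [DC cD DT]] := LX [set A `*` setT | A in C].
- by move=> _ [A CA <-]; apply: openX; [apply: oC|apply: openT].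
- apply/seteqP; split=> // -[a b] _.
  have [A CA Aa] : (\bigcup_(A in C) A) a by rewrite CT.
  by exists (A `*` setT) => //; exists A.
exists (C `&` [set A | D (A `*` setT)]); split=> [A []//||].
  have /countable_injP[f fI] := cD; apply/countable_injP.
  exists (fun A => f (A `*` setT)) => A A' /[!inE] -[_ DA] [_ DA'].
  move=> /fI /[!inE] /(_ DA DA') AA'.
  have setE (E : set X) : E = [set a | (E `*` [set: bool]) (a, true)].
    by apply/seteqP; split=> a //= [].
  by rewrite (setE A) AA' -setE.
apply/seteqP; split=> // a _.
have [S DS Sa] : (\bigcup_(A in D) A) (a, true) by rewrite DT.
have [A CA AS] := DC S DS; exists A; last by move: Sa; rewrite -AS => -[].
by split=> //=; rewrite AS.
Qed.

Section Noncovers.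
Variables (X : topologicalType) (Om : choiceType).
Hypothesis PX : productively_lindelof X.
Variables (Y : set X) (B : Om -> set X).
Hypothesis cY : open (~` Y).
Hypothesis oB : forall a, open (B a).

Definition noncover : set (set Om) :=
  [set z | exists2 y, Y y & forall a, z a -> ~ B a y].

(** A cover of [Y], together with the open complement of [Y], covers the Lindelöf space [X]. *)
Lemma noncover_witnessed : countably_witnessed noncover.
Proof.
split=> [z w wz [y Yy zy]|z nz].
  by exists y => // a /wz; apply: zy.
have [||D [DC cD DT]] := productively_lindelof_lindelof PX
    (C := [set ~` Y] `|` (B @` z)).
- by move=> _ [->|[a _ <-]].
- apply/seteqP; split=> // y _; have [Yy|nY] := pselect (Y y); last first.
    by exists (~` Y) => //; left.
  apply: contrapT => h; apply: nz; exists y => // a za Ba; apply: h.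
  by exists (B a) => //; right; exists a.
have /choice[f fP] U : exists w, D U -> [/\ countable w, w `<=` z &
    U `<=` ~` Y `|` \bigcup_(a in w) B a].
  have [/DC[->|[a za <-]]|] := pselect (D U).
  - by exists set0 => _; split=> // y; left.
  - exists [set a] => _; split; [exact: countable1|by move=> _ ->|].
    by move=> y Ba; right; exists a.
  - by exists set0.
exists (\bigcup_(U in D) f U); split.
- by apply: bigcup_countable => // U /fP[].
- by move=> a [U /fP[_ wz _] /wz].
move=> [y Yy yw]; have [U DU Uy] : (\bigcup_(A in D) A) y by rewrite DT.
have [_ _ /(_ y Uy)[//|[a fa Ba]]] := fP U DU.
by apply: yw Ba; exists U.
Qed.

Variables (le : Om -> Om -> Prop) (e : Om -> set (seq Om)).
Hypothesis leP : omega1_order le.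
Hypothesis e_surj : forall O, countable O -> exists a, e a = O.

(* If no countable union of the closed sets [avoid (e a)] missing [P] covered the
   non-covers, one could pick for each [a] a non-cover [x a] outside all of those with
   index below [a]. The points [x a], made isolated, are then concentrated around
   the Lindelöf set [P]; the resulting space is Lindelöf, but its product with [X]
   is not. *)
Lemma noncover_separation : separates_lindelof e noncover.
Proof.
move=> P PN PL; apply: contrapT => nA.
have [lexx _ le_total le_count unc] := leP.
pose good a := forall z, P z -> ~ avoid (e a) z.
have /choice[x xP] c : exists z, noncover z /\
    forall a, le a c -> good a -> ~ avoid (e a) z.
  apply: contrapT => h; apply: nA; exists ([set a | le a c] `&` good); split.
  - by apply: sub_countable (le_count c); apply: subset_card_le => a [].
  - by move=> a z [_ /(_ z)].
  move=> z Nz; apply: contrapT => h'; apply: h; exists z; split=> // a ac ga az.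
  by apply: h'; exists a.
pose p (t : {z | P z}) := sval t.
pose Z := test_space p x.
have LZ : lindelof Z.
  move=> C oC CT.
  have inC (t : Z) : (\bigcup_(A in C) A) t by rewrite CT.
  pose fits (F : seq Om) (A : set Z) := [/\ C A,
    forall t, [set` F] `<=` p t -> A (inl t) &
    forall a, [set` F] `<=` x a -> A (inr a)].
  have [z Pz az|O' [cO' O'O PO']] := PL [set F | exists A, fits F A].
    have [A CA At] := inC (inl (exist _ z Pz)).
    have [F [Fz FA FA']] := test_openP (oC A CA) At.
    by apply: (az F) => //; exists A.
  have /choice[AF AFP] F : exists A, O' F -> fits F A.
    by have [/O'O[A]|] := pselect (O' F); [exists A|exists set0].
  have /choice[Aa AaP] a : exists A, C A /\ A (inr a).
    by have [A] := inC (inr a); exists A.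
  (* The code [b] of the countable subfamily is good, so the sets chosen for [P] also contain every
     [inr a] with [a] above [b]; only countably many points remain. *)
  have [b eb] := e_surj cO'.
  have gb : good b by rewrite /good eb.
  exists (AF @` O' `|` Aa @` [set a | le a b]); split.
  - move=> _ [[F OF <-]|[a _ <-]]; first by case: (AFP F OF).
    by case: (AaP a).
  - apply: countableU; first exact: (countable_surj cO' (@subset_refl _ _)).
    exact: (countable_surj (le_count b) (@subset_refl _ _)).
  apply/seteqP; split=> // -[[z Pz]|a] _.
    have [F OF Fz] := not_avoid (PO' z Pz).
    exists (AF F); first by left; exists F.
    by case: (AFP F OF) => _ + _; apply.
  have [ba|ab] := le_total b a; last first.
    by exists (Aa a); [right; exists a|case: (AaP a)].
  have := (xP a).2 b ba gb; rewrite eb => /not_avoid[F OF Fx].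
  exists (AF F); first by left; exists F.
  by case: (AFP F OF) => _ _; apply.
(* If [y] witnesses that [x c] is a non-cover, then [single c] is the only member of [C] containing
   [(y, inr c)]. So a subcover needs all of these uncountably many sets. *)
pose V a : set Z := [set t | match t with inl t => p t a | inr c => x c a end].
pose single c : set (X * Z) := setT `*` [set inr c].
pose C : set (set (X * Z)) := [set B a `*` V a | a in setT] `|`
  [set single c | c in setT] `|` [set ~` Y `*` setT].
have [||D [DC cD DT]] := @PX Z LZ C.
- move=> _ [[[a _ <-]|[c _ <-]]|->]; apply: openX;
    [exact: oB| |exact: openT| |exact: cY|exact: openT].
    apply: open_test => t pta; exists [:: a]; split=> //.
    + by move=> b; rewrite /= inE => /eqP->.
    + by move=> t'; apply; rewrite /= mem_head.
    + by move=> c; apply; rewrite /= mem_head.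
  by apply: open_test => t.
- apply/seteqP; split=> // -[y [[z Pz]|c]] _; last first.
    by exists (single c) => //; left; right; exists c.
  have [Yy|nY] := pselect (Y y); last first.
    by exists (~` Y `*` setT) => //; right.
  apply: contrapT => h; apply: (PN z Pz); exists y => // a za Ba; apply: h.
  by exists (B a `*` V a) => //; left; left; exists a.
have [c nc] : exists c, ~ D (single c).
  apply: contrapT => h; apply: unc.
  have /countable_injP[f fI] := cD; apply/countable_injP.
  have Ds a : D (single a) by apply: contrapT => n; apply: h; exists a.
  exists (fun a => f (single a)) => a a' _ _ /fI; rewrite !inE => /(_ (Ds a) (Ds a')).
  have [[y _ _] _] := xP a => ss.
  have : single a (y, inr a) by [].
  by rewrite ss => -[_ [->]].
have [[y Yy yx] _] := xP c.
have [S DS] : (\bigcup_(A in D) A) (y, inr c) by rewrite DT.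
move: (DS); case: (DC S DS) => [[[a _ <-]|[a _ <-]]|->].
- by move=> _ [/= Ba /yx].
- by move=> Da [_ /= [ca]]; apply: nc; rewrite ca.
- by move=> _ [].
Qed.

End Noncovers.

(** * Consequences of CH *)

Lemma countable_range T (A : set T) :
  countable A -> A !=set0 -> exists h : nat -> T, range h = A.
Proof.
move=> /countable_injP[f fI] [t0 At0].
have /choice[h hP] n : exists b, A b /\ forall a, A a -> f a = n -> b = a.
  have [[a Aa fa]|nA] := pselect (exists2 a, A a & f a = n).
    by exists a; split=> // b Ab fb; apply: fI; rewrite ?inE // fa fb.
  by exists t0; split=> // a Aa fa; case: nA; exists a.
exists h; apply/seteqP; split=> [_ [n _ <-]|a Aa]; first by case: (hP n).
by exists (f a) => //; case: (hP (f a)) => _; apply.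
Qed.

Lemma uncountable_set_nat : ~ countable [set: set nat].
Proof.
move=> /countable_injP[f fI].
pose E : set nat := [set n | exists2 A, f A = n & ~ A n].
have nE : ~ E (f E).
  move=> /[dup] EfE [A /fI /[!inE] /(_ I I) ->]; exact.
by apply: (nE); exists E.
Qed.

(** Well-order the reals. If some initial segment is uncountable, take the least point with such a
    segment: CH makes its strict segment equinumerous with the reals, and the order is pulled back
    along a bijection. *)
Lemma CH_omega1_order : CH ->
  exists le : set nat -> set nat -> Prop, omega1_order le.
Proof.
move=> ch; have [R Rwo] := well_ordering_principle (set nat : eqType).
have minP (A : set (set nat)) : A !=set0 ->
    exists2 z, A z & forall y, A y -> R z y.
  move=> [a Aa]; have [|z [[zA zm] _]] := Rwo (mem A); first by exists a; apply/mem_set.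
  by exists z => [|y Ay]; [apply/set_mem|apply/zm/mem_set].
have Rtot a b : R a b \/ R b a.
  have [|z [->|->] zm] := minP [set x | x = a \/ x = b]; first by exists a; left.
    by left; apply: zm; right.
  by right; apply: zm; left.
have Rxx a : R a a by case: (Rtot a a).
have Ranti a b : R a b -> R b a -> a = b.
  move=> ab ba; have [|z [_ uz]] := Rwo (mem [set x | x = a \/ x = b]).
    by exists a; apply/mem_set; left.
  have za : z = a.
    apply: uz; split; first by apply/mem_set; left.
    by move=> x /set_mem[->|->].
  have zb : z = b.
    apply: uz; split; first by apply/mem_set; right.
    by move=> x /set_mem[->|->].
  by rewrite -za.
have Rtr a b c : R a b -> R b c -> R a c.
  move=> ab bc; have [|z zA zm] := minP [set x | [\/ x = a, x = b | x = c]].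
    by exists a; constructor.
  have za : R z a by apply: zm; constructor 1.
  have zb : R z b by apply: zm; constructor 2.
  have zc : R z c by apply: zm; constructor 3.
  case: zA => zE; rewrite zE in za zb zc; first by [].
    by rewrite (Ranti a b).
  by rewrite -(Ranti b c).
have [segc|/existsNP[a na]] := pselect (forall a, countable [set b | R b a]).
  exists R; split=> //; exact: uncountable_set_nat.
have [|a0 na0 a0m] := minP [set a | ~ countable [set b | R b a]]; first by exists a.
pose S := [set b | R b a0 /\ b <> a0].
have Sc b : S b -> countable [set c | R c b].
  move=> [ba nba]; apply: contrapT => nb; apply: nba.
  by apply: Ranti => //; apply: a0m.
have [cS|/card_esym/card_set_bijP[f [fS fI _]]] := ch S.
  case: na0; apply: (sub_countable (B := S `|` [set a0])).
    apply: subset_card_le => b /= ba; have [->|ne] := pselect (b = a0); first by right.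
    by left.
  by apply: countableU => //; apply: countable1.
exists (fun x y => R (f x) (f y)); split=> //.
- by move=> x y z; apply: Rtr.
- move=> x; have /countable_injP[g gI] := Sc (f x) (fS x I).
  apply/countable_injP; exists (g \o f) => y z /[!inE] yx zx /= /gI.
  by rewrite !inE => /(_ yx zx); apply: fI; rewrite inE.
- exact: uncountable_set_nat.
Qed.

(* A countable family of finite sets of reals is coded by one real, which records a
   sequence [h] of reals and the words [c] such that [map h c] is in the family. *)
Definition decode (A : set nat) : set (seq (set nat)) :=
  let mem (t : nat * nat + seq nat) := A (choice.pickle t) in
  [set map (fun n => [set k | mem (inl (n, k))]) c | c in [set c | mem (inr c)]].

Lemma countable_decode A : countable (decode A).
Proof. exact: (countable_surj (countableP _) (@subset_refl _ _)). Qed.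

Lemma decode_surj O : countable O -> exists A, decode A = O.
Proof.
(* Adding [set0] leaves something to enumerate when [O] has no letters. *)
move=> cO; have [||h hE] := @countable_range _ (letters O `|` [set set0]).
- exact: countableU (countable_letters cO) (countable1 _).
- by exists set0; right.
have hP a : letters O a -> exists n, h n = a.
  move=> Oa; have : (letters O `|` [set set0]) a by left.
  by rewrite -hE => -[n]; exists n.
pose A : set nat := [set m | exists t : nat * nat + seq nat, choice.pickle t = m /\
  match t with inl nk => h nk.1 nk.2 | inr c => O (map h c) end].
have AE t : A (choice.pickle t) =
    match t with inl nk => h nk.1 nk.2 | inr c => O (map h c) end.
  apply/propext; split=> [[t' [tt']]|]; last by exists t.
  by rewrite (pcan_inj choice.pickleK tt').
have hA : (fun n => [set k | A (choice.pickle (inl (n, k) : nat * nat + seq nat))]) = h.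
  by apply/funext => n; apply/seteqP; split=> k /=; rewrite AE.
exists A; rewrite /decode hA; apply/seteqP; split=> [_ [c + <-]|s Os].
  by rewrite /= AE.
suff [c cs] : exists c, map h c = s by exists c => //=; rewrite AE cs.
have : [set` s] `<=` letters O by move=> a sa; exists s.
elim: s {Os} => [_|a s IH asO]; first by exists [::].
have [b sb|c cs] := IH; first by apply: asO; rewrite /= inE orbC [b \in s]sb.
have [n na] : exists n, h n = a by apply/hP/asO; rewrite /= mem_head.
by exists (n :: c); rewrite /= na cs.
Qed.

(** * Reduction to continuum many points and open sets *)

Inductive tree := Leaf | Node of nat & (nat -> tree).

Fixpoint label t (s : seq nat) : option nat :=
  match t, s with
  | Leaf, _ => None
  | Node k _, [::] => Some k
  | Node _ f, i :: s' => label (f i) s'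
  end.

Lemma label_inj t t' : label t =1 label t' -> t = t'.
Proof.
elim: t t' => [|k f IH] [|k' f'] tt' //; try by have := tt' [::].
have [->] := tt' [::]; congr Node; apply/funext => i; apply: IH => s.
exact: tt' (i :: s).
Qed.

(* The closure of a point under countably many operations of countable arity is the
   image of the well-founded trees, and a tree is coded by a set of labelled nodes. *)
Lemma continuum_closed (P : Type) (p0 : P) (op : nat -> (nat -> P) -> P) :
  exists g : set nat -> P, [/\ exists a, g a = p0,
    forall k (v : nat -> set nat), exists a, g a = op k (g \o v) &
    forall a, g a = p0 \/ exists k w, g a = op k w].
Proof.
pose eval := fix eval t := match t with
  Leaf => p0 | Node k f => op k (fun n => eval (f n)) end.
pose code t : set nat :=
  [set m | exists s k, choice.pickle (s, k) = m /\ label t s = Some k].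
have code_inj t t' : code t = code t' -> t = t'.
  move=> tt'; apply: label_inj => s.
  have codeE u k : code u (choice.pickle (s, k)) = (label u s = Some k).
    apply/propext; split=> [[s' [k' [/(pcan_inj choice.pickleK)[-> ->]]]]//|us].
    by exists s, k.
  case ts : (label t s) => [k|].
    by apply/esym; rewrite -codeE -tt' codeE.
  case t's : (label t' s) => [k|//].
  by move: t's; rewrite -codeE -tt' codeE ts.
have /choice[tr trP] a : exists t, forall t', code t' = a -> t = t'.
  have [[t ta]|h] := pselect (exists t, code t = a).
    by exists t => t' t'a; apply: code_inj; rewrite ta.
  by exists Leaf => t' t'a; case: h; exists t'.
have codeK t : tr (code t) = t by apply: trP.
exists (eval \o tr); split.
- by exists (code Leaf); rewrite /= codeK.
- by move=> k v; exists (code (Node k (tr \o v))); rewrite /= codeK.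
- move=> a /=; case: (tr a) => [|k f]; first by left.
  by right; exists k, (fun n => eval (f n)).
Qed.

(** The boxes around [y] generate a filter converging to [y] in each coordinate, hence in the
    product; so some box lies in [U]. *)
Lemma ptws_box (X : topologicalType) (y : {ptws nat -> X}) (U : set {ptws nat -> X}) :
  open U -> U y -> exists L : seq (nat * set X),
    [/\ forall p, p \in L -> open p.2, forall p, p \in L -> p.2 (y p.1) &
        forall z : nat -> X, (forall p, p \in L -> p.2 (z p.1)) -> U z].
Proof.
move=> oU Uy.
pose G := filter_from [set L : seq (nat * set X) |
  (forall p, p \in L -> open p.2) /\ (forall p, p \in L -> p.2 (y p.1))]
  (fun L => [set z : {ptws nat -> X} | forall p, p \in L -> p.2 (z p.1)]).
have FG : Filter G.
  apply: filter_from_filter; first by exists [::]; split.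
  move=> L1 L2 [o1 y1] [o2 y2]; exists (L1 ++ L2).
    by split=> p; rewrite mem_cat => /orP[]; [exact: o1|exact: o2|exact: y1|exact: y2].
  by move=> z zL; split=> p pL; apply: zL; rewrite mem_cat pL ?orbT.
have Gy : G --> y.
  apply/cvg_sup => i A; rewrite nbhsE => -[_ [[B oB <-] By] BA].
  apply: filterS BA _; exists [:: (i, B)].
    by split=> p; rewrite inE => /eqP->.
  by move=> z /(_ (i, B) (mem_head _ _)).
have [L [oL yL] LU] := Gy U (open_nbhs_nbhs (conj oU Uy)).
by exists L; split.
Qed.

Lemma T3_limit_unique (X : topologicalType) (u : nat -> X) (x y : X) :
  T3_space X -> u @ \oo --> x -> u @ \oo --> y -> x = y.
Proof.
move=> [reg acc] ux uy; apply: contrapT => /eqP xy.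
have [A [oA /set_mem Ax /set_mem nAy]] := acc x y xy.
have [V Vx VA] := reg x A (open_nbhs_nbhs (conj oA Ax)).
have nVy : nbhs y (~` V).
  apply: contrapT => nV; apply: nAy; apply: VA => W Wy.
  apply: contrapT => VW; apply: nV; apply: filterS Wy => a Wa Va.
  by apply: VW; exists a.
have [n [Vn]] := filter_ex (filterI (ux V Vx) (uy _ nVy)).
exact.
Qed.

Theorem theorem1p4 : CH ->
  forall X : topologicalType,
    productively_lindelof X -> sequential_space X -> T3_space X ->
    powerfully_lindelof X.
Proof.
move=> ch X PX seqX T3X C oC CT.
have [[x0 _]|X0] := pselect ([set: X] !=set0); last first.
  exists set0; split=> //; apply/seteqP; split=> // x _.
  by case: X0; exists (x 0%N).
have /choice[lim limP] (u : nat -> X) :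
    exists x : X, forall y, u @ \oo --> y -> x = y.
  have [[x ux]|nu] := pselect (exists x : X, u @ \oo --> x).
    by exists x => y; apply: T3_limit_unique ux.
  by exists x0 => y uy; case: nu; exists y.
have /choice[box boxP] (y : nat -> X) : exists L : seq (nat * set X),
    [/\ forall p, p \in L -> open p.2, forall p, p \in L -> p.2 (y p.1) &
      exists2 U, C U & forall z : nat -> X, (forall p, p \in L -> p.2 (z p.1)) -> U z].
  have [U CU Uy] : (\bigcup_(U in C) U) y by rewrite CT.
  by have [L [oL yL LU]] := ptws_box (oC U CU) Uy; exists L; split=> //; exists U.
(* [V] codes a sequence of boxes: the [j]-th restricts coordinate [i] to the sets at the codes of
   [(j, i, m)]. The point [x] is in none of them. *)
pose missed (V : nat -> set X) (x : nat -> X) :=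
  forall j : nat, exists i m : nat, ~ V (choice.pickle (j, i, m)) (x i).
have /choice[wit witP] (V : nat -> set X) :
    exists x : nat -> X, (exists z, missed V z) -> missed V x.
  by have [[x]|] := pselect (exists z, missed V z); [exists x|exists (fun=> x0)].
(* Points and open sets are closed off together: points under sequential limits ([k = 0]) and under
   coordinates of [wit], open sets under the sides of the chosen boxes. *)
pose op k (v : nat -> X * set X) : X * set X :=
  (if k is k'.+1 then wit (snd \o v) k' else lim (fst \o v),
   (nth (0%N, setT) (box (fst \o v)) k).2).
have [g [[aT gT] gop gor]] := continuum_closed (x0, setT) op.
pose Y : set X := range (fst \o g).
pose B a := (g a).2.
have oB a : open (B a).
  rewrite /B; have [->|[k [w ->]]] := gor a; first exact: openT.
  rewrite /=; have [lt|le] := ltnP k (size (box (fst \o w))).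
    by have [+ _ _] := boxP (fst \o w); apply; apply: mem_nth.
  by rewrite nth_default //; apply: openT.
have pick_index (x : nat -> X) : (forall i, Y (x i)) ->
    exists v : nat -> set nat, fst \o g \o v = x.
  move=> Yx; have /choice[v vP] i : exists a, (g a).1 = x i.
    by have [a _ <-] := Yx i; exists a.
  by exists v; apply/funext.
have cY : open (~` Y).
  apply: closed_openC; apply: seqX => u x Yu ux.
  have [v vu] := pick_index u Yu; have [a ga] := gop 0%N v.
  exists a => //=; rewrite ga /=; apply: limP.
  by rewrite [X in X @ _](_ : _ = u) // -vu.
have [le leP] := CH_omega1_order ch.
pose BB : set (seq (nat * set nat)) := [set s | exists2 U, C U &
  forall z : nat -> X, (forall p, p \in s -> B p.2 (z p.1)) -> U z].
have [x Nx|S [cS SB SP]] := countable_subcover_power leP countable_decode decode_surj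
    (noncover_witnessed PX cY oB) (noncover_separation PX cY oB leP decode_surj)
    (BB := BB).
  have /choice[y yP] i : exists y, Y y /\ forall a, x i a -> ~ B a y.
    by have [y Yy yx] := Nx i; exists y.
  have [v vy] := pick_index y (fun i => (yP i).1).
  have /choice[b bP] k : exists b, B b = (nth (0%N, setT) (box y) k).2.
    have [b gb] := gop k v; exists b; rewrite /B gb /=.
    by rewrite (_ : fst \o _ = y) // -vy.
  have [_ yL [U CU LU]] := boxP y.
  exists (mkseq (fun k => ((nth (0%N, setT) (box y) k).1, b k)) (size (box y))).
    exists U => // z zs; apply: LU => p pL.
    have := zs (p.1, b (index p (box y))).
    rewrite /= bP nth_index //; apply; apply/mapP; exists (index p (box y)).
      by rewrite mem_iota /= add0n index_mem.
    by rewrite nth_index.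
  move=> _ /mapP[k /[!mem_iota]/= ltk ->] /= xb.
  by apply: (yP _).2 xb _; rewrite bP; apply/yL/mem_nth.
have SY (x : nat -> X) : (forall i, Y (x i)) ->
    exists2 s, S s & forall p, p \in s -> B p.2 (x p.1).
  move=> Yx; have [i|s Ss ds] := SP (fun i => [set a | ~ B a (x i)]).
    by exists (x i) => // a.
  by exists s => // p /ds /contrapT.
have SX (z : nat -> X) : exists2 s, S s & forall p, p \in s -> B p.2 (z p.1).
  apply: contrapT => nz.
  have [|h hS] := countable_range cS.
    have [i|s Ss _] := SY (fun=> x0); last by exists s.
    by exists aT => //=; rewrite gT.
  have Sh j : S (h j) by rewrite -hS; exists j.
  (* Codes the boxes of [S] for [missed]; the filler [aT] stands for the whole space and imposes no
     restriction. If these boxes missed a point of [X^omega], they would miss the point given by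
     [wit], whose coordinates are in [Y]. *)
  pose v n : set nat := if choice.unpickle n is Some (j, i, m) then
    let q := nth (0%N, aT) (h j) m in if q.1 == i then q.2 else aT else aT.
  have vE j i m : v (choice.pickle (j, i, m)) =
      let q := nth (0%N, aT) (h j) m in if q.1 == i then q.2 else aT.
    by rewrite /v choice.pickleK.
  have mis : missed (snd \o (g \o v)) (wit (snd \o (g \o v))).
    apply: witP; exists z => j; apply: contrapT => hj; apply: nz.
    exists (h j) => // p pj; apply: contrapT => nB; apply: hj.
    exists p.1, (index p (h j)) => /=; rewrite vE /= nth_index //.
    by rewrite eqxx.
  have [i|s Ss sw] := SY (wit (snd \o (g \o v))).
    by have [a ga] := gop i.+1 v; exists a => //=; rewrite ga.
  move: (Ss); rewrite -hS => -[j _ hj]; have [i [m]] := mis j; apply.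
  rewrite /= vE /=; set q := nth _ _ _; case: eqP => [<-|_]; last by rewrite gT.
  have [ltm|lem] := ltnP m (size (h j)).
    by apply: sw; rewrite -hj; apply: mem_nth.
  by rewrite /q nth_default //= gT.
have /choice[U UP] s : exists U, S s -> C U /\
    forall z : nat -> X, (forall p, p \in s -> B p.2 (z p.1)) -> U z.
  by have [/SB[U]|] := pselect (S s); [exists U|exists setT].
exists (U @` S); split.
- by move=> _ [s /UP[CU _] <-].
- exact: (countable_surj cS (@subset_refl _ _)).
- apply/seteqP; split=> // z _; have [s Ss sz] := SX z.
  by exists (U s); [exists s|apply: (UP s Ss).2].
Qed.
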